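(* Let $d=\min\{d_A,d_B\}\ge2$ and let $\rho=|\psi\rangle\langle\psi|$ be a pure state on $\mathbb{C}^{d_A}\otimes\mathbb{C}^{d_B}$ with Schmidt decomposition $|\psi\rangle=\sum_{i=1}^{d}\sqrt{\mu_i}\,|u_i\rangle_A\otimes|v_i\rangle_B$, where $\mu_1\ge\cdots\ge\mu_d\ge0$ and $\sum_i\mu_i=1$. Then the Wasserstein entanglement measure satisfies $$\mathcal{E}(\rho)\;\ge\;\frac1d\left(\Bigl(\sum_{i=1}^d\sqrt{\mu_i}\Bigr)^2-1\right)\;\ge\;0 .$$ For the maximally entangled state ($\mu_i=1/d$ for all $i$), the middle expression equals $(d-1)/d$.
   Context: Let $\mathcal{H}_A=\mathbb{C}^{d_A}$, $\mathcal{H}_B=\mathbb{C}^{d_B}$, $\mathcal{H}_{AB}=\mathcal{H}_A\otimes\mathcal{H}_B$. Write $\mathcal{D}(\mathcal{H})$ for the density operators on $\mathcal{H}$, $\|\cdot\|_{op}$ for the operator norm, and $\mathcal{SEP}(\mathcal{H}_{AB})$ for the set of separable states (convex combinations of product states $\sigma_A\otimes\sigma_B$). Fix a family $\{F_i^A\}_{i=1}^{d_A^2-1}$ of traceless Hermitian $d_A\times d_A$ matrices with $\operatorname{Tr}(F_i^AF_j^A)=\delta_{ij}$ and $\|F_i^A\|_{op}\le1$, and similarly a family $\{F_j^B\}_{j=1}^{d_B^2-1}$ for $B$. Let $\mathcal{K}_0=\{F_i^A\otimes I_B\}_i\cup\{I_A\otimes F_j^B\}_j$. On two copies $\mathcal{H}_{AB}^{(1)}\otimes\mathcal{H}_{AB}^{(2)}$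 of $\mathcal{H}_{AB}$ define the cost operator $$C=\sum_{X\in\mathcal{K}_0}\bigl(X\otimes I_{AB}^{(2)}-I_{AB}^{(1)}\otimes X\bigr)^2 .$$ For $\rho,\sigma\in\mathcal{D}(\mathcal{H}_{AB})$ let $\Pi(\rho,\sigma)$ be the set of density operators on $\mathcal{H}_{AB}^{(1)}\otimes\mathcal{H}_{AB}^{(2)}$ with marginals $\rho$ and $\sigma$. The quantum Wasserstein distance of order 1 is $W_1(\rho,\sigma)=\bigl(\inf_{\tau\in\Pi(\rho,\sigma)}\operatorname{Tr}[C\tau]\bigr)^{1/2}$, and the Wasserstein entanglement measure is $$\mathcal{E}(\rho)=\inf_{\sigma\in\mathcal{SEP}(\mathcal{H}_{AB})}W_1(\rho,\sigma).$$ *)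

(* Defs.v *)
From mathcomp Require Import all_boot all_order all_algebra.
From mathcomp Require Import spectral sesquilinear.
From mathcomp Require Import classical_sets reals.
From mathcomp Require Import complex mxtens.

Set Implicit Arguments.
Unset Strict Implicit.
Unset Printing Implicit Defensive.

Import Order.TTheory GRing.Theory Num.Theory.

Local Open Scope ring_scope.
Local Open Scope sesquilinear_scope.
Local Open Scope complex_scope.
Local Open Scope classical_set_scope.

(* R is an arbitrary model of the reals. The complex numbers are R[i],
   operators on C^n are 'M[R[i]]_n, vectors of C^n are columns, and the tensor
   product is the Kronecker product *t, with C^m (x) C^n represented by
   C^(m * n) through mxtens_index. *)

Section Matrices.
Variable R : realType.

Definition tensv m n (u : 'cV[R[i]]_m) (v : 'cV[R[i]]_n) : 'cV[R[i]]_(m * n) :=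
  u *t v.

Definition l2norm n (v : 'cV[R[i]]_n) : R :=
  Num.sqrt (\sum_i ComplexField.Normc.normc (v i 0) ^+ 2).

Definition opnorm n (M : 'M[R[i]]_n) : R :=
  sup [set l2norm (M *m v) | v in [set v : 'cV[R[i]]_n | l2norm v <= 1]].

Definition orthonormal_family n d (u : 'I_d -> 'cV[R[i]]_n) : Prop :=
  forall i j, ((u i)^t* *m u j) 0 0 = (i == j)%:R.

(* The order of R[i] is partial: 0 <= z says that z is real and nonnegative. *)
Definition possemidef n (M : 'M[R[i]]_n) : Prop :=
  M \is hermsymmx /\ forall v : 'cV[R[i]]_n, 0 <= (v^t* *m M *m v) 0 0.

Definition density n (M : 'M[R[i]]_n) : Prop := possemidef M /\ \tr M = 1.

Definition pure_state n (psi : 'cV[R[i]]_n) : 'M[R[i]]_n := psi *m psi^t*.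

Definition ptrace1 m n (M : 'M[R[i]]_(m * n)) : 'M[R[i]]_n :=
  \matrix_(i, j) \sum_(k < m) M (mxtens_index (k, i)) (mxtens_index (k, j)).

Definition ptrace2 m n (M : 'M[R[i]]_(m * n)) : 'M[R[i]]_m :=
  \matrix_(i, j) \sum_(k < n) M (mxtens_index (i, k)) (mxtens_index (j, k)).

Definition separable dA dB (sigma : 'M[R[i]]_(dA * dB)) : Prop :=
  exists (n : nat) (p : 'I_n -> R)
         (sA : 'I_n -> 'M[R[i]]_dA) (sB : 'I_n -> 'M[R[i]]_dB),
    [/\ forall k, 0 <= p k,
        \sum_k p k = 1,
        forall k, density (sA k),
        forall k, density (sB k)
      & sigma = \sum_k (p k)%:C *: (sA k *t sB k)].

Definition schmidt_decomposition dA dB d (psi : 'cV[R[i]]_(dA * dB))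
    (mu : 'I_d -> R) (u : 'I_d -> 'cV[R[i]]_dA) (v : 'I_d -> 'cV[R[i]]_dB) :
    Prop :=
  [/\ orthonormal_family u,
      orthonormal_family v,
      (forall i j : 'I_d, (i <= j)%N -> mu j <= mu i),
      (forall i, 0 <= mu i) /\ \sum_i mu i = 1
    & psi = \sum_i (Num.sqrt (mu i))%:C *: tensv (u i) (v i)].

Definition observable_family d (F : 'I_(d ^ 2 - 1) -> 'M[R[i]]_d) : Prop :=
  [/\ forall i, F i \is hermsymmx,
      forall i, \tr (F i) = 0,
      forall i j, \tr (F i *m F j) = (i == j)%:R
    & forall i, opnorm (F i) <= 1].

End Matrices.

Section Wasserstein.
Variables (R : realType) (dA dB : nat).
Variables (FA : 'I_(dA ^ 2 - 1) -> 'M[R[i]]_dA)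
          (FB : 'I_(dB ^ 2 - 1) -> 'M[R[i]]_dB).

(* The set K_0, as a family indexed by a disjoint union; for observable
   families its members are pairwise distinct, being nonzero and
   Hilbert-Schmidt orthogonal, so sums over the family are sums over the set. *)
Definition K0 (x : 'I_(dA ^ 2 - 1) + 'I_(dB ^ 2 - 1)) : 'M[R[i]]_(dA * dB) :=
  match x with
  | inl i => FA i *t 1%:M
  | inr j => 1%:M *t FB j
  end.

Definition cost : 'M[R[i]]_((dA * dB) * (dA * dB)) :=
  \sum_x (K0 x *t 1%:M - 1%:M *t K0 x) ^+ 2.

Definition coupling (rho sigma : 'M[R[i]]_(dA * dB)) :
    set 'M[R[i]]_((dA * dB) * (dA * dB)) :=
  [set tau | [/\ density tau, ptrace2 tau = rho & ptrace1 tau = sigma]].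

(* Tr[C tau] is real and nonnegative, as C and tau are positive semidefinite;
   Re only casts it to R. For density operators rho and sigma, rho *t sigma
   is a coupling, so this is the infimum of a nonempty set bounded below, as is
   the one in [wasserstein_entanglement]. *)
Definition W1 (rho sigma : 'M[R[i]]_(dA * dB)) : R :=
  Num.sqrt (inf [set complex.Re (\tr (cost *m tau))
                | tau in coupling rho sigma]).

Definition wasserstein_entanglement (rho : 'M[R[i]]_(dA * dB)) : R :=
  inf [set W1 rho sigma | sigma in [set s | separable s]].

End Wasserstein.

(* Main.v *)
(* Completeness of {F_i} together with 1/sqrt d gives sum_i F_i^2 = d - 1/d and
   sum_i F_i (x) F_i = SWAP - 1/d.  Hence, S denoting the swap of the two A
   factors, the A part of the cost is 2 (dA - S) = 2 (dA - 1) + (1 - S)^2, and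
   the B part is a sum of squares of Hermitian operators.  So every coupling of
   any two states costs at least 2 (dA - 1) >= 2, and every W1 is at least 1,
   whereas the claimed bound is at most (d - 1) / d because
   (sum_i sqrt mu_i)^2 <= d.  Separability is used only to know that sigma is a
   density operator, so that rho (x) sigma is a coupling: in Rocq the infimum of
   the empty set is 0. *)
Require Import Defs.
From mathcomp Require Import all_boot all_order all_algebra.
From mathcomp Require Import perm spectral sesquilinear.
From mathcomp Require Import classical_sets reals.
From mathcomp Require Import complex mxtens.
From mathcomp Require Import ring lra.

Set Implicit Arguments.
Unset Strict Implicit.
Unset Printing Implicit Defensive.

Import Order.TTheory GRing.Theory Num.Theory.

Local Open Scope ring_scope.
Local Open Scope sesquilinear_scope.
Local Open Scope complex_scope.

(** * Adjoints and positive semidefinite matrices *)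

Lemma adjmxM (C : numClosedFieldType) m n p (A : 'M[C]_(m, n)) (B : 'M_(n, p)) :
  (A *m B)^t* = B^t* *m A^t*.
Proof. by rewrite trmx_mul map_mxM. Qed.

Lemma adjmx_tens (C : numClosedFieldType) m n p q
    (A : 'M[C]_(m, n)) (B : 'M_(p, q)) : (A *t B)^t* = A^t* *t B^t*.
Proof. by rewrite trmx_tens map_mxT. Qed.

Lemma adjmxB (C : numClosedFieldType) m n (A B : 'M[C]_(m, n)) :
  (A - B)^t* = A^t* - B^t*.
Proof. by rewrite linearB map_mxB. Qed.

Lemma adjmxZ (C : numClosedFieldType) m n (a : C) (A : 'M[C]_(m, n)) :
  0 <= a -> (a *: A)^t* = a *: A^t*.
Proof. by move=> a_ge0; rewrite linearZ map_mxZ /= geC0_conj. Qed.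

Lemma hermsymmxE (C : numClosedFieldType) n (A : 'M[C]_n) :
  (A \is hermsymmx) = (A == A^t*).
Proof. by rewrite qualifE /= expr0 scale1r. Qed.

Lemma gram_diag_ge0 (C : numClosedFieldType) m n (B : 'M[C]_(m, n)) i :
  0 <= (B *m B^t*) i i.
Proof.
by rewrite mxE sumr_ge0 // => k _; rewrite !mxE mul_conjC_ge0.
Qed.

Lemma possemidef_gram (R : realType) m n (B : 'M[R[i]]_(m, n)) :
  possemidef (B^t* *m B).
Proof.
split; first by rewrite hermsymmxE adjmxM trmxCK.
by move=> v; rewrite mulmxA -adjmxM -mulmxA -{2}[B *m v]trmxCK gram_diag_ge0.
Qed.

(** Spectral theorem: M = P^* D P with P unitary, and B = sqrt(D) P. The test vectors P^* e_i turn
    positivity of the form into D_i >= 0. *)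
Lemma possemidefP (R : realType) n (M : 'M[R[i]]_n) :
  possemidef M -> exists B : 'M_n, M = B^t* *m B.
Proof.
case=> Mherm Mpos; set P := spectralmx M; set D := spectral_diag M.
have MPD : M = P^t* *m diag_mx D *m P.
  rewrite -invmx_unitary ?spectral_unitarymx //.
  exact/orthomx_spectralP/hermitian_normalmx.
have PP : P *m P^t* = 1%:M by apply/unitarymxP/spectral_unitarymx.
have D_ge0 i : 0 <= D 0 i.
  have := Mpos (P^t* *m delta_mx i 0).
  rewrite adjmxM trmxCK MPD !mulmxA -[_ *m P *m P^t*]mulmxA PP mulmx1.
  rewrite -[_ *m P *m P^t*]mulmxA PP mulmx1.
  by rewrite trmx_delta map_delta_mx -rowE -colE !mxE eqxx mulr1n.
pose S := diag_mx (map_mx sqrtC D).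
have SS : S^t* *m S = diag_mx D.
  rewrite tr_diag_mx map_diag_mx mulmx_diag; congr diag_mx.
  apply/rowP=> i; rewrite !mxE.
  rewrite -[RHS]sqrtCK expr2; congr (_ * _).
  by apply: geC0_conj; rewrite sqrtC_ge0.
by exists (S *m P); rewrite adjmxM !mulmxA -[_ *m S^t* *m S]mulmxA SS.
Qed.

Lemma possemidef_tens (R : realType) m n (A : 'M[R[i]]_m) (B : 'M[R[i]]_n) :
  possemidef A -> possemidef B -> possemidef (A *t B).
Proof.
move=> /possemidefP[X ->] /possemidefP[Y ->].
by rewrite -tensmx_mul -adjmx_tens; apply: possemidef_gram.
Qed.

Lemma tr_gram_possemidef_ge0 (R : realType) m n (Y : 'M[R[i]]_(m, n)) (tau : 'M_n) :
  possemidef tau -> 0 <= \tr (Y^t* *m Y *m tau).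
Proof.
move=> /possemidefP[B ->]; rewrite mulmxA mxtrace_mulC -mulmxA mulmxA.
have -> : B *m (Y^t* *m Y *m B^t*) = (B *m Y^t*) *m (B *m Y^t*)^t*.
  by rewrite adjmxM trmxCK !mulmxA.
by apply: sumr_ge0 => i _; apply: gram_diag_ge0.
Qed.

Lemma possemidefD (R : realType) n (A B : 'M[R[i]]_n) :
  possemidef A -> possemidef B -> possemidef (A + B).
Proof.
rewrite /possemidef !hermsymmxE => -[/eqP Ah Ap] [/eqP Bh Bp]; split.
  by rewrite linearD map_mxD -Ah -Bh.
by move=> v; rewrite mulmxDr mulmxDl mxE addr_ge0.
Qed.

Lemma possemidefZ (R : realType) n (a : R[i]) (A : 'M[R[i]]_n) :
  0 <= a -> possemidef A -> possemidef (a *: A).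
Proof.
rewrite /possemidef !hermsymmxE => a_ge0 [/eqP Ah Ap]; split.
  by rewrite adjmxZ // -Ah.
by move=> v; rewrite -scalemxAr -scalemxAl mxE mulr_ge0.
Qed.

(** * Product couplings, separable states and pure states *)

Lemma mxtrace_tens (C : comPzRingType) m n (A : 'M[C]_m) (B : 'M_n) :
  \tr (A *t B) = \tr A * \tr B.
Proof.
by rewrite /mxtrace mulr_sum; apply: eq_bigr => k _; rewrite mxE.
Qed.

Lemma ptrace2_tens (R : realType) m n (A : 'M[R[i]]_m) (B : 'M_n) :
  ptrace2 (A *t B) = \tr B *: A.
Proof.
apply/matrixP=> i j; rewrite !mxE mulrC mulr_sumr.
by apply: eq_bigr => k _; rewrite tensmxE.
Qed.

Lemma ptrace1_tens (R : realType) m n (A : 'M[R[i]]_m) (B : 'M_n) :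
  ptrace1 (A *t B) = \tr A *: B.
Proof.
apply/matrixP=> i j; rewrite !mxE mulr_suml.
by apply: eq_bigr => k _; rewrite tensmxE.
Qed.

Lemma density_tens (R : realType) m n (A : 'M[R[i]]_m) (B : 'M_n) :
  density A -> density B -> density (A *t B).
Proof.
move=> [Ap At] [Bp Bt]; split; first exact: possemidef_tens.
by rewrite mxtrace_tens At Bt mulr1.
Qed.

Lemma coupling_tens (R : realType) dA dB (rho sigma : 'M[R[i]]_(dA * dB)) :
  density rho -> density sigma -> coupling rho sigma (rho *t sigma).
Proof.
move=> hr hs; split; first exact: density_tens.
- by rewrite ptrace2_tens hs.2 scale1r.
- by rewrite ptrace1_tens hr.2 scale1r.
Qed.

Lemma separable_density (R : realType) dA dB (sigma : 'M[R[i]]_(dA * dB)) :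
  separable sigma -> density sigma.
Proof.
move=> [n [p [sA [sB [p0 p1 hA hB ->]]]]]; split.
  apply: (big_ind (fun M => possemidef M)) => [|A B|k _].
  - have := possemidef_gram (0 : 'M[R[i]]_(1, dA * dB)).
    by rewrite mulmx0.
  - exact: possemidefD.
  - apply: possemidefZ; first by rewrite ler0c.
    by apply: possemidef_tens; [case: (hA k) | case: (hB k)].
rewrite linear_sum /=.
under eq_bigr => k _ do rewrite linearZ /= (density_tens (hA k) (hB k)).2 mulr1.
by rewrite -rmorph_sum p1.
Qed.

Lemma density_pure_state (R : realType) n (psi : 'cV[R[i]]_n) :
  (psi^t* *m psi) 0 0 = 1 -> density (pure_state psi).
Proof.
move=> psi1; split.
  by rewrite /pure_state -{1}[psi]trmxCK; apply: possemidef_gram.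
by rewrite /pure_state mxtrace_mulC /mxtrace big_ord1.
Qed.

(** * Completeness relation for observable families *)

Lemma sum_mxtens_index (V : nmodType) m n (f : 'I_(m * n) -> V) :
  \sum_k f k = \sum_(i < m) \sum_(j < n) f (mxtens_index (i, j)).
Proof.
rewrite pair_bigA /= (reindex (@mxtens_index m n)) /=.
  by apply: eq_bigr => -[].
by exists (@mxtens_unindex m n) => k _; rewrite (mxtens_indexK, mxtens_unindexK).
Qed.

Lemma mxtens_index_eq m n (x y : 'I_m * 'I_n) :
  (mxtens_index x == mxtens_index y) = (x == y).
Proof. exact/inj_eq/can_inj/mxtens_indexK. Qed.

(** Serves the sizes d^2 - 1 + 1 and d * d, which are equal but not convertible. *)
Lemma mulmx1C_cast (C : comNzRingType) m n (A : 'M[C]_(m, n)) (B : 'M_(n, m)) :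
  m = n -> A *m B = 1%:M -> B *m A = 1%:M.
Proof. by move=> mn; case: n / mn A B => A B; apply: mulmx1C. Qed.

(* Together with the identity, the F i form a basis of the matrix space dual,
   for the trace pairing, to (F i) and (1/d); this is the expansion of the
   matrix units in that basis. *)
Lemma observable_completeness (R : realType) d (F : 'I_(d ^ 2 - 1) -> 'M[R[i]]_d)
    (a b c e : 'I_d) :
  observable_family F ->
  \sum_i F i a b * F i c e
    = ((a == e) && (b == c))%:R - d%:R^-1 * ((a == b) && (c == e))%:R.
Proof.
case=> _ trF trFF _.
have d_gt0 : (0 < d)%N by apply: leq_ltn_trans (ltn_ord a).
pose fst_ (k : 'I_(d * d)) := (mxtens_unindex k).1.
pose snd_ (k : 'I_(d * d)) := (mxtens_unindex k).2.
have fst_E x y : fst_ (mxtens_index (x, y)) = x by rewrite /fst_ mxtens_indexK.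
have snd_E x y : snd_ (mxtens_index (x, y)) = y by rewrite /snd_ mxtens_indexK.
(* The rows of G are the F_i and the identity, flattened; the columns of H are the dual family, with
   transposed indices so that G H collects traces of products. *)
pose G := col_mx (\matrix_(i, k) F i (fst_ k) (snd_ k))
                 (\row_k (fst_ k == snd_ k)%:R : 'rV[R[i]]_(d * d)).
pose H := row_mx (\matrix_(k, i) F i (snd_ k) (fst_ k))
                 (\col_k (d%:R^-1 * (fst_ k == snd_ k)%:R) : 'cV[R[i]]_(d * d)).
have trE (A : 'M[R[i]]_d) : \sum_(i < d) \sum_(j < d) A i j * (i == j)%:R = \tr A.
  apply: eq_bigr => i _; rewrite (bigD1 i) //= eqxx mulr1 big1 ?addr0 // => j.
  by rewrite eq_sym => /negbTE->; rewrite mulr0.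
have GH : G *m H = 1%:M.
  rewrite mul_col_row -[1%:M]submxK; congr block_mx; apply/matrixP=> i j.
  - rewrite !mxE (inj_eq (@lshift_inj _ _)) -trFF sum_mxtens_index.
    apply: eq_bigr => k _; rewrite mxE; apply: eq_bigr => l _.
    by rewrite !mxE fst_E snd_E.
  - rewrite !mxE eq_lrshift sum_mxtens_index.
    transitivity (d%:R^-1 * \tr (F i)); last by rewrite trF mulr0.
    rewrite -trE mulr_sumr; apply: eq_bigr => k _.
    rewrite mulr_sumr; apply: eq_bigr => l _.
    by rewrite !mxE fst_E snd_E mulrCA.
  - rewrite !mxE eq_rlshift sum_mxtens_index.
    transitivity (\tr (F j)); last by rewrite trF.
    rewrite -trE exchange_big; apply: eq_bigr => k _; apply: eq_bigr => l _.
    by rewrite !mxE fst_E snd_E mulrC eq_sym.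
  - rewrite !mxE (inj_eq (@rshift_inj _ _)) !ord1 eqxx sum_mxtens_index.
    transitivity (d%:R^-1 * \tr (1%:M : 'M[R[i]]_d)); last first.
      by rewrite mxtrace1 mulVf // pnatr_eq0 -lt0n.
    rewrite -trE mulr_sumr; apply: eq_bigr => k _.
    rewrite mulr_sumr; apply: eq_bigr => l _.
    by rewrite !mxE fst_E snd_E mulrCA.
(* The subtraction is truncated, so d > 0 matters. G and H are then square up to this cast, so G H =
   1 yields H G = 1, whose entry at ((b, a), (c, e)) is the claim. *)
have sz : (d ^ 2 - 1 + 1 = d * d)%N by rewrite subnK ?expn_gt0 ?d_gt0 // mulnn.
have /matrixP/(_ (mxtens_index (b, a)) (mxtens_index (c, e))) := mulmx1C_cast sz GH.
rewrite mul_row_col !mxE big_ord1 !mxE mxtens_index_eq xpair_eqE !fst_E !snd_E /= andbC => <-.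
rewrite [a == b]eq_sym -mulnb natrM mulrA addrK.
by apply: eq_bigr => i _; rewrite !mxE !fst_E !snd_E.
Qed.

(** Completeness with b = c, summed over b: the first delta contributes d times, the second once. *)
Lemma observable_sum_sqr (R : realType) d (F : 'I_(d ^ 2 - 1) -> 'M[R[i]]_d) :
  observable_family F -> \sum_i F i *m F i = (d%:R - d%:R^-1)%:M.
Proof.
move=> hF; apply/matrixP=> a e; rewrite summxE mxE.
under eq_bigr => i _ do rewrite mxE.
rewrite exchange_big /=.
under eq_bigr => b _ do rewrite (observable_completeness _ _ _ _ hF) eqxx andbT.
rewrite sumrB -mulr_sumr sumr_const card_ord.
rewrite (bigD1 a) //= eqxx big1 => [|j].
  by rewrite addr0 mulrnBl mulr_natr; case: (a == e); rewrite ?mulr1 ?mulr0 ?mul0rn.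
by rewrite eq_sym => /negbTE->.
Qed.

(** * The exchange S of the two left tensor factors, and the left part of the cost *)

Definition swap_left m n (k : 'I_((m * n) * (m * n))) : 'I_((m * n) * (m * n)) :=
  let x := mxtens_unindex (mxtens_unindex k).1 in
  let y := mxtens_unindex (mxtens_unindex k).2 in
  mxtens_index (mxtens_index (y.1, x.2), mxtens_index (x.1, y.2)).

Lemma swap_leftK m n : involutive (@swap_left m n).
Proof.
move=> k; case: k / (mxtens_indexP k) => x y.
case: x / (mxtens_indexP x) => a b; case: y / (mxtens_indexP y) => c e.
by rewrite /swap_left !mxtens_indexK.
Qed.

Definition swap_mx (C : pzSemiRingType) m n : 'M[C]_((m * n) * (m * n)) :=
  perm_mx (perm (inv_inj (@swap_leftK m n))).

Lemma swap_mx_sqr (C : pzSemiRingType) m n : swap_mx C m n *m swap_mx C m n = 1%:M.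
Proof.
rewrite -perm_mxM -perm_mx1; congr perm_mx.
by apply/permP=> k; rewrite permM !permE swap_leftK.
Qed.

Lemma swap_mx_adj (C : numClosedFieldType) m n : (swap_mx C m n)^t* = swap_mx C m n.
Proof.
rewrite tr_perm_mx map_perm_mx; congr perm_mx; apply/permP=> k.
by apply: (@perm_inj _ (perm (inv_inj (@swap_leftK m n)))); rewrite permKV !permE swap_leftK.
Qed.

(** Each entry splits into a completeness sum over the left indices and deltas on the right ones;
    the crossed delta of completeness is exactly S. *)
Lemma observable_sum_tens (R : realType) m n (F : 'I_(m ^ 2 - 1) -> 'M[R[i]]_m) :
  observable_family F ->
  \sum_i (F i *t (1%:M : 'M_n)) *t (F i *t (1%:M : 'M_n))
    = swap_mx R[i] m n - (m%:R^-1)%:M.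
Proof.
move=> hF; apply/matrixP=> k l.
case: k / (mxtens_indexP k) => x y; case: l / (mxtens_indexP l) => x' y'.
case: x / (mxtens_indexP x) => a b; case: y / (mxtens_indexP y) => c e.
case: x' / (mxtens_indexP x') => a' b'; case: y' / (mxtens_indexP y') => c' e'.
rewrite summxE !mxE permE /swap_left !mxtens_indexK /= !mxtens_index_eq !xpair_eqE.
rewrite !mxtens_index_eq !xpair_eqE.
transitivity (\sum_i F i a a' * F i c c' * ((b == b') && (e == e'))%:R).
  by apply: eq_bigr => i _; rewrite !tensmxE !mxE -mulnb natrM mulrACA.
rewrite -mulr_suml (observable_completeness _ _ _ _ hF) mulrBl; congr (_ - _).
  rewrite -natrM mulnb; congr (nat_of_bool _)%:R.
  by rewrite [c == a']eq_sym; do !case: (_ == _).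
rewrite -mulrA -natrM mulnb -[RHS]mulr_natr.
by congr (_ * (nat_of_bool _)%:R); do !case: (_ == _).
Qed.

Lemma tensmxDl (C : pzRingType) m n p q (A A' : 'M[C]_(m, n)) (B : 'M_(p, q)) :
  (A + A') *t B = A *t B + A' *t B.
Proof. by apply/matrixP=> i j; rewrite !mxE mulrDl. Qed.

Lemma tensmxDr (C : pzRingType) m n p q (A : 'M[C]_(m, n)) (B B' : 'M_(p, q)) :
  A *t (B + B') = A *t B + A *t B'.
Proof. by apply/matrixP=> i j; rewrite !mxE mulrDr. Qed.

Lemma tensmx_suml (C : pzRingType) m n p q (I : finType)
    (A : I -> 'M[C]_(m, n)) (B : 'M_(p, q)) :
  (\sum_i A i) *t B = \sum_i A i *t B.
Proof.
exact: (big_morph (fun A => A *t B) (fun A A' => tensmxDl A A' B) (tens0mx B)).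
Qed.

Lemma tensmx_sumr (C : pzRingType) m n p q (I : finType)
    (A : 'M[C]_(m, n)) (B : I -> 'M_(p, q)) :
  A *t (\sum_i B i) = \sum_i A *t B i.
Proof. exact: (big_morph (fun B => A *t B) (tensmxDr A) (tensmx0 A)). Qed.

Lemma tensmx_scalar (C : pzRingType) m n (a b : C) :
  (a%:M : 'M_m) *t (b%:M : 'M_n) = (a * b)%:M.
Proof.
apply/matrixP=> i j.
case: i / (mxtens_indexP i) => i1 i2; case: j / (mxtens_indexP j) => j1 j2.
rewrite tensmxE !mxE mxtens_index_eq xpair_eqE.
by do 2!case: (_ == _); rewrite ?mulr0n ?mulr1n ?mul0r ?mulr0.
Qed.

(** Expanding the squares gives 2(m - 1/m) - 2(S - 1/m) = 2(m - S). As S is a self-adjoint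
    involution, (1 - S)^*(1 - S) = 2 - 2S, which leaves the constant 2(m - 1). *)
Lemma cost_leftE (R : realType) m n (F : 'I_(m ^ 2 - 1) -> 'M[R[i]]_m) :
  observable_family F ->
  \sum_i ((F i *t (1%:M : 'M_n)) *t 1%:M - 1%:M *t (F i *t (1%:M : 'M_n))) ^+ 2
    = (m%:R - 1)%:M *+ 2
      + (1%:M - swap_mx R[i] m n)^t* *m (1%:M - swap_mx R[i] m n).
Proof.
move=> hF; pose X i := F i *t (1%:M : 'M[R[i]]_n).
have sqX : \sum_i X i *m X i = (m%:R - m%:R^-1)%:M.
  under eq_bigr => i _ do rewrite tensmx_mul mulmx1.
  by rewrite -tensmx_suml observable_sum_sqr // tensmx_scalar mulr1.
transitivity (\sum_i ((X i *m X i) *t 1%:M + 1%:M *t (X i *m X i) - (X i *t X i) *+ 2)).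
  apply: eq_bigr => i _; rewrite -/(X i) expr2 -mulmxE.
  rewrite mulmxBl !mulmxBr !tensmx_mul !mulmx1 !mul1mx.
  by rewrite opprB addrACA mulr2n opprD.
rewrite sumrB big_split /= -tensmx_suml -tensmx_sumr sqX.
rewrite sumrMnl observable_sum_tens // !tensmx_scalar mulr1 mul1r.
rewrite adjmxB trmx1 map_mx1 swap_mx_adj.
rewrite mulmxBl !mulmxBr mulmx1 !mul1mx mulmx1 swap_mx_sqr.
apply/matrixP=> k l; rewrite !mxE.
by case: (k == l); rewrite ?mulr1n ?mulr0n; ring.
Qed.

(** * Lower bounds on the transport cost and on [W1] *)

Lemma cost_trace_ge (R : realType) dA dB
    (FA : 'I_(dA ^ 2 - 1) -> 'M[R[i]]_dA) (FB : 'I_(dB ^ 2 - 1) -> 'M[R[i]]_dB)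
    (tau : 'M_((dA * dB) * (dA * dB))) :
  observable_family FA -> observable_family FB -> density tau ->
  (dA%:R - 1) *+ 2 <= \tr (cost FA FB *m tau).
Proof.
move=> hFA hFB [tau_pos tau1]; rewrite /cost big_sumType /= cost_leftE //.
rewrite mulr2n !mulmxDl !mxtraceD !mul_scalar_mx mxtraceZ tau1 mulr1.
rewrite -mulr2n -addrA lerDl addr_ge0 ?tr_gram_possemidef_ge0 //.
rewrite mulmx_suml raddf_sum sumr_ge0 // => j _.
(* Each B term is the square of a Hermitian Y, hence the Gram matrix Y^* Y, and its trace against
   tau is nonnegative. *)
set Y := (_ - _); have YY : Y = Y^t*.
  case: hFB => /(_ j); rewrite hermsymmxE => /eqP FBj _ _ _.
  by rewrite /Y adjmxB !adjmx_tens !trmx1 !map_mx1 -FBj.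
by rewrite expr2 -mulmxE {1}YY; apply: tr_gram_possemidef_ge0.
Qed.

Lemma W1_ge1 (R : realType) dA dB
    (FA : 'I_(dA ^ 2 - 1) -> 'M[R[i]]_dA) (FB : 'I_(dB ^ 2 - 1) -> 'M[R[i]]_dB)
    (rho sigma : 'M[R[i]]_(dA * dB)) :
  (2 <= dA)%N -> observable_family FA -> observable_family FB ->
  density rho -> density sigma -> 1 <= W1 FA FB rho sigma.
Proof.
move=> dA_ge2 hFA hFB hrho hsigma; rewrite -[1]sqrtr1 ler_wsqrtr //.
apply: lb_le_inf => [|_ [tau [htau _ _] <-]].
  (* The product coupling shows that the infimum is over a nonempty set. *)
  exists (complex.Re (\tr (cost FA FB *m (rho *t sigma)))).
  by exists (rho *t sigma); [exact: coupling_tens|].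
have := cost_trace_ge hFA hFB htau; rewrite lecE => /andP[_]; apply: le_trans.
(* The bound is an embedded real, so its real part is the same expression in R. *)
have /= -> : complex.Re ((dA%:R - 1) *+ 2 : R[i]) = (dA%:R - 1) *+ 2 :> R.
  rewrite -[in LHS](rmorph_nat (real_complex R)) -(rmorph1 (real_complex R)).
  by rewrite -rmorphB -rmorphMn.
have : 2%:R <= dA%:R :> R by rewrite ler_nat.
lra.
Qed.

(** * Schmidt coefficients *)

Lemma schmidt_norm (R : realType) dA dB d (psi : 'cV[R[i]]_(dA * dB))
    (mu : 'I_d -> R) (u : 'I_d -> 'cV[R[i]]_dA) (v : 'I_d -> 'cV[R[i]]_dB) :
  schmidt_decomposition psi mu u v -> (psi^t* *m psi) 0 0 = 1.
Proof.
move=> [hu hv _ [mu_ge0 mu1] ->].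
have tensE i j : ((tensv (u i) (v i))^t* *m tensv (u j) (v j)) 0 0 = (i == j)%:R.
  (* A 1 x 1 tensor product has its only entry at a tensor index, which must be identified with
     0. *)
  have e0 : mxtens_index (0 : 'I_1, 0 : 'I_1) = 0 by apply: val_inj.
  have := tensmxE ((u i)^t* *m u j) ((v i)^t* *m v j) 0 0 0 0.
  by rewrite -tensmx_mul -adjmx_tens e0 hu hv -natrM mulnb andbb.
rewrite mulmx_sumr summxE.
transitivity (\sum_i (mu i)%:C); last by rewrite -rmorph_sum mu1.
apply: eq_bigr => i _.
rewrite raddf_sum map_mx_sum mulmx_suml summxE.
under eq_bigr => j _ do
  rewrite adjmxZ ?ler0c ?sqrtr_ge0 // -scalemxAr -scalemxAl 2!mxE tensE.
rewrite (bigD1 i) //= big1 => [|j /negbTE->]; last by rewrite !mulr0.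
by rewrite eqxx addr0 mulr1 -rmorphM -expr2 sqr_sqrtr.
Qed.

(** The diagonal terms of the expanded square already sum to 1, and the cross terms are
    nonnegative. *)
Lemma sum_sqrt_ge1 (R : rcfType) d (mu : 'I_d -> R) :
  (forall i, 0 <= mu i) -> \sum_i mu i = 1 -> 1 <= (\sum_i Num.sqrt (mu i)) ^+ 2.
Proof.
move=> mu_ge0 mu1; rewrite expr2 mulr_suml -mu1; apply: ler_sum => i _.
rewrite -{1}[mu i]sqr_sqrtr // expr2 ler_wpM2l ?sqrtr_ge0 //.
by rewrite (bigD1 i) //= lerDl sumr_ge0 // => j _; apply: sqrtr_ge0.
Qed.

(* AM-GM on each product sqrt (mu i) sqrt (mu j). *)
Lemma sum_sqrt_le (R : rcfType) d (mu : 'I_d -> R) :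
  (forall i, 0 <= mu i) -> \sum_i mu i = 1 ->
  (\sum_i Num.sqrt (mu i)) ^+ 2 <= d%:R.
Proof.
move=> mu_ge0 mu1.
(* Since the mu i sum to 1, d is the double sum of their pairwise means, so the comparison is
   termwise. *)
have -> : d%:R = \sum_i \sum_j ((mu i + mu j) / 2%:R).
  under eq_bigr => i _ do rewrite -mulr_suml big_split /= sumr_const mu1 card_ord.
  rewrite -mulr_suml big_split /= sumrMnl mu1 sumr_const card_ord -mulr2n.
  by rewrite -[X in _ = X / _]mulr_natr mulfK ?pnatr_eq0.
rewrite expr2 mulr_suml; apply: ler_sum => i _.
rewrite mulr_sumr; apply: ler_sum => j _.
rewrite ler_pdivlMr ?ltr0n //.
have := sqr_ge0 (Num.sqrt (mu i) - Num.sqrt (mu j)).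
rewrite sqrrB !sqr_sqrtr //; lra.
Qed.

Theorem theorem3 (R : realType) (dA dB d : nat)
    (hd : d = minn dA dB) (hd2 : (2 <= d)%N)
    (FA : 'I_(dA ^ 2 - 1) -> 'M[R[i]]_dA) (FB : 'I_(dB ^ 2 - 1) -> 'M[R[i]]_dB)
    (hFA : observable_family FA) (hFB : observable_family FB)
    (psi : 'cV[R[i]]_(dA * dB)) (mu : 'I_d -> R)
    (u : 'I_d -> 'cV[R[i]]_dA) (v : 'I_d -> 'cV[R[i]]_dB)
    (hpsi : schmidt_decomposition psi mu u v) :
  [/\ wasserstein_entanglement FA FB (pure_state psi)
        >= d%:R^-1 * ((\sum_i Num.sqrt (mu i)) ^+ 2 - 1),
      d%:R^-1 * ((\sum_i Num.sqrt (mu i)) ^+ 2 - 1) >= 0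
    & (forall i, mu i = d%:R^-1) ->
      d%:R^-1 * ((\sum_i Num.sqrt (mu i)) ^+ 2 - 1) = (d%:R - 1) / d%:R].
Proof.
have [hu hv _ [mu_ge0 mu1] _] := hpsi.
have d_gt0 : 0 < d%:R :> R by rewrite ltr0n ltnW.
split.
(* The number 1 separates the two sides: the bound is at most (d - 1) / d, and every [W1] is at
   least 1. *)
- apply: (@le_trans _ _ 1).
    rewrite mulrC ler_pdivrMr // mul1r lerBlDr.
    by apply: le_trans (sum_sqrt_le mu_ge0 mu1) _; rewrite lerDl.
  have dA_ge2 : (2 <= dA)%N by move: hd2; rewrite hd leq_min => /andP[].
  apply: lb_le_inf => [|_ [sigma /= hsigma <-]]; last first.
    apply: W1_ge1 => //; last exact: separable_density.
    exact/density_pure_state/(schmidt_norm hpsi).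
  (* Nonemptiness of the separable states: the product of the first Schmidt vectors, as a one-term
     convex combination. *)
  have i0 : 'I_d by exists 0%N; apply: ltnW.
  exists (W1 FA FB (pure_state psi) (pure_state (u i0) *t pure_state (v i0))).
  exists (pure_state (u i0) *t pure_state (v i0)) => //=.
  exists 1%N, (fun=> 1), (fun=> pure_state (u i0)), (fun=> pure_state (v i0)).
  split=> [//||_|_|]; last by rewrite big_ord1 scale1r.
  + by rewrite big_ord1.
  + by apply: density_pure_state; rewrite hu eqxx.
  + by apply: density_pure_state; rewrite hv eqxx.
- by apply: mulr_ge0; rewrite ?subr_ge0 ?sum_sqrt_ge1 // invr_ge0 ltW.
(* It remains that (d sqrt(1/d))^2 = d^2 / d = d. *)
- move=> mu_unif; rewrite mulrC; congr ((_ - _) / _).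
  under eq_bigr => i _ do rewrite mu_unif.
  rewrite sumr_const card_ord exprMn_n sqr_sqrtr ?invr_ge0 ?ltW //.
  by rewrite -[LHS]mulr_natr natrX expr2 mulKf // gt_eqF.
Qed.
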